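(* Let $H$ be a definite Bethe--Salpeter matrix. A structured BSE Krylov decomposition of type III of $H$ of order $k$ keeps its structure under (similarity) transformations of the form $\begin{bmatrix}Q_1 & 0\\ 0 & Q_2\end{bmatrix}$, with orthogonal $Q_1,Q_2\in\mathbb{R}^{k\times k}$. That is, applying such a similarity transformation to a structured BSE Krylov decomposition of type III yields again a structured BSE Krylov decomposition of type III.
   Context: Notation: $\overline{\,\cdot\,}$ is entrywise complex conjugation, $\cdot^*$ conjugate transpose. Definite Bethe--Salpeter matrix: $H=\begin{bmatrix}R & C\\ -\overline{C} & -\overline{R}\end{bmatrix}\in\mathbb{C}^{2n\times 2n}$ with $R=R^*$, $C=C^T$ in $\mathbb{C}^{n\times n}$, such that $\hat H=\begin{bmatrix}R & C\\ \overline{C} & \overline{R}\end{bmatrix}$ is (Hermitian) positive definite. Type III: a structured BSE Krylov decomposition of type III (of order $k$) is a relation $$H\begin{bmatrix}U_k & V_k\\ \overline{U}_k & -\overline{V}_k\end{bmatrix}=\begin{bmatrix}U_k & V_k\\ \overline{U}_k & -\overline{V}_k\end{bmatrix}\begin{bmatrix}0 & \hat K_k\\ \hat K_k^* & 0\end{bmatrix}+\begin{bmatrix}u_{k+1} & v_{k+1}\\ \overline{u}_{k+1} & -\overline{v}_{k+1}\end{bmatrix}\begin{bmatrix}0 & \hat k_{k+1}^*\\ \hat f_{k+1}^* & 0\end{bmatrix},$$ with $U_k,V_k\in\mathbb{C}^{n\times k}$, $u_{k+1},v_{k+1}\in\mathbb{C}^n$, where $\hat K_k\in\mathbb{R}^{k\times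 k}$ is not necessarily symmetric, $\hat f_{k+1},\hat k_{k+1}\in\mathbb{R}^k$, and either $\hat f_{k+1}=0$ or $\hat k_{k+1}=0$. As for any Krylov decomposition, the basis of the decomposition, i.e. the columns of $\begin{bmatrix}U_k & u_{k+1} & V_k & v_{k+1}\\ \overline{U}_k & \overline{u}_{k+1} & -\overline{V}_k & -\overline{v}_{k+1}\end{bmatrix}$, is linearly independent. Similarity transformation: applying a similarity transformation with an invertible matrix $G$ to a relation $HX=XM+EN$ (basis $X$, Rayleigh quotient $M$, residual term $EN$) means passing to $H(XG)=(XG)(G^{-1}MG)+E(NG)$. *)

(* Defs.v *)
From HB Require Import structures.
From mathcomp Require Import all_boot all_order all_algebra.
From mathcomp Require Import complex reals.

Set Implicit Arguments.
Unset Strict Implicit.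
Unset Printing Implicit Defensive.

Import Order.TTheory GRing.Theory Num.Theory.

Local Open Scope ring_scope.
Local Open Scope sesquilinear_scope.

(* The order on R[i] is partial: 0 < z means that z is real and positive. *)
Definition posdefmx (R : realType) (m : nat) (A : 'M[R[i]]_m) : Prop :=
  A \is hermsymmx /\
  forall x : 'cV[R[i]]_m, x != 0 -> 0 < (x ^t* *m A *m x) 0 0.

Definition definite_bse (R : realType) (n : nat) (H : 'M[R[i]]_(n + n)) : Prop :=
  exists A B : 'M[R[i]]_n,
    [/\ A \is hermsymmx, B \is symmetricmx,
        H = block_mx A B (- map_mx Num.conj B) (- map_mx Num.conj A) &
        posdefmx (block_mx A B (map_mx Num.conj B) (map_mx Num.conj A))].

Definition orthogonalmx (R : realType) (k : nat) (Q : 'M[R]_k) : Prop :=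
  Q^T *m Q = 1%:M.

Definition to_complex (R : realType) (p q : nat) (A : 'M[R]_(p, q)) :
  'M[R[i]]_(p, q) := map_mx (real_complex R) A.

Definition bse_block (R : realType) (n m : nat) (U V : 'M[R[i]]_(n, m)) :
  'M[R[i]]_(n + n, m + m) :=
  block_mx U V (map_mx Num.conj U) (- map_mx Num.conj V).

(* The relation H X = X M + E N is a structured BSE Krylov decomposition of
   type III of order k; u, v, kap, f stand for u_{k+1}, v_{k+1},
   \hat k_{k+1}, \hat f_{k+1}.  The columns of
   bse_block (row_mx U u) (row_mx V v) are those of the basis in the order
   U u V v. *)
Definition bse_krylov_III (R : realType) (n k : nat) (H : 'M[R[i]]_(n + n))
  (X : 'M[R[i]]_(n + n, k + k)) (M : 'M[R[i]]_(k + k))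
  (E : 'M[R[i]]_(n + n, 1 + 1)) (N : 'M[R[i]]_(1 + 1, k + k)) : Prop :=
  exists (U V : 'M[R[i]]_(n, k)) (u v : 'cV[R[i]]_n)
         (K : 'M[R]_k) (kap f : 'cV[R]_k),
    [/\ X = bse_block U V,
        M = block_mx 0 (to_complex K) ((to_complex K) ^t*) 0,
        E = bse_block u v &
        N = block_mx 0 ((to_complex kap) ^t*) ((to_complex f) ^t*) 0] /\
    [/\ H *m X = X *m M + E *m N,
        f = 0 \/ kap = 0 &
        row_free (bse_block (row_mx U u) (row_mx V v))^T].

(* Main.v *)
Require Import Defs.
From HB Require Import structures.
From mathcomp Require Import all_boot all_order all_algebra.
From mathcomp Require Import complex reals.

(** The transformation G = diag(Q1, Q2) is real and orthogonal, and both
    properties are used.  Since G is real, right multiplication by it commutes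
    with entrywise conjugation, so the shape [U V; conj U, - conj V] of the
    basis survives, with U Q1 and V Q2 in the role of U and V
    ([bse_block_mul_real]).  Since G is orthogonal, its inverse is its
    transpose diag(Q1^T, Q2^T); hence the Rayleigh quotient becomes
    [0, Q1^T K Q2; Q2^T K^* Q1, 0], whose off-diagonal blocks are again adjoint
    to each other, with the real block Q1^T K Q2 in the role of K.  The residual
    rows become k^* Q2 and f^* Q1, so k and f are replaced by Q2^T k and Q1^T f,
    and the one that vanishes still does.

    The residual vectors u and v do not change, so the full basis, in the order
    U u V v, is multiplied by diag(Q1, 1, Q2, 1).  This matrix is again of the
    form diag(P1, P2) with real orthogonal blocks P1 = diag(Q1, 1) and
    P2 = diag(Q2, 1); it is invertible, so linear independence is kept. *)

Set Implicit Arguments.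
Unset Strict Implicit.
Unset Printing Implicit Defensive.

Import Order.TTheory GRing.Theory Num.Theory.

Local Open Scope ring_scope.
Local Open Scope sesquilinear_scope.

Lemma to_complexM (R : realType) (p q r : nat) (A : 'M[R]_(p, q))
  (B : 'M[R]_(q, r)) :
  to_complex (A *m B) = to_complex A *m to_complex B.
Proof. exact: map_mxM. Qed.

Lemma to_complex1 (R : realType) (p : nat) :
  to_complex (1%:M : 'M[R]_p) = 1%:M.
Proof. exact: map_mx1. Qed.

Lemma to_complex_block_diag (R : realType) (p q : nat) (A : 'M[R]_p)
  (B : 'M[R]_q) :
  to_complex (block_mx A 0 0 B) = block_mx (to_complex A) 0 0 (to_complex B).
Proof. by rewrite /to_complex map_block_mx !map_mx0. Qed.

Lemma conj_to_complex (R : realType) (p q : nat) (A : 'M[R]_(p, q)) :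
  map_mx Num.conj (to_complex A) = to_complex A.
Proof. by apply/matrixP=> i j; rewrite !mxE; apply: conjc_real. Qed.

Lemma adjoint_to_complex (R : realType) (p q : nat) (A : 'M[R]_(p, q)) :
  (to_complex A) ^t* = to_complex A^T.
Proof. by rewrite -[LHS]/(map_mx _ _) /to_complex map_trmx; apply: conj_to_complex. Qed.

Lemma orthogonal_block_diag (R : realType) (p q : nat) (A : 'M[R]_p)
  (B : 'M[R]_q) :
  orthogonalmx A -> orthogonalmx B -> orthogonalmx (block_mx A 0 0 B).
Proof.
rewrite /orthogonalmx => oA oB.
by rewrite tr_block_mx !trmx0 mulmx_block !mulmx0 !mul0mx !addr0 add0r oA oB
  -scalar_mx_block.
Qed.

Lemma to_complex_orthogonal_unit (R : realType) (p : nat) (A : 'M[R]_p) :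
  orthogonalmx A -> to_complex A \in unitmx.
Proof.
move=> oA.
suff /mulmx1_unit[] : to_complex A^T *m to_complex A = 1%:M by [].
by rewrite -to_complexM oA to_complex1.
Qed.

Lemma invmx_to_complex_orthogonal (R : realType) (p : nat) (A : 'M[R]_p) :
  orthogonalmx A -> invmx (to_complex A) = to_complex A^T.
Proof.
move=> oA; rewrite -[LHS]mul1mx -to_complex1 -oA to_complexM.
exact/mulmxK/to_complex_orthogonal_unit.
Qed.

(** Real coefficients pass through the conjugation in the lower half, so they
    act on U and V separately. *)
Lemma bse_block_mul_real (R : realType) (n p q : nat) (U V : 'M[R[i]]_(n, p))
  (A B : 'M[R]_(p, q)) :
  bse_block U V *m block_mx (to_complex A) 0 0 (to_complex B) =
  bse_block (U *m to_complex A) (V *m to_complex B).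
Proof.
by rewrite /bse_block mulmx_block !mulmx0 !addr0 !add0r !map_mxM
  !conj_to_complex mulNmx.
Qed.

(** The column u takes part in the extended basis but not in the rotation;
    absorbing it into the orthogonal matrix diag(Q, 1) lets
    [bse_block_mul_real] apply to the extended basis too. *)
Lemma row_mx_mul_block_diag1 (R : realType) (n k : nat) (U : 'M[R[i]]_(n, k))
  (u : 'cV[R[i]]_n) (Q : 'M[R]_k) :
  row_mx (U *m to_complex Q) u =
  row_mx U u *m to_complex (block_mx Q 0 0 (1%:M : 'M_1)).
Proof.
by rewrite to_complex_block_diag to_complex1 mul_row_block !mulmx0 mulmx1
  addr0 add0r.
Qed.

Lemma row_free_tr_mul_unit (F : fieldType) (m p : nat) (X : 'M[F]_(m, p))
  (G : 'M[F]_p) :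
  G \in unitmx -> row_free X^T -> row_free (X *m G)^T.
Proof.
move=> uG fX; rewrite trmx_mul /row_free mxrankMfree //.
by rewrite -/(row_free G^T) row_free_unit unitmx_tr.
Qed.

Theorem proposition4 (R : realType) (n k : nat) (H : 'M[R[i]]_(n + n))
  (X : 'M[R[i]]_(n + n, k + k)) (M : 'M[R[i]]_(k + k))
  (E : 'M[R[i]]_(n + n, 1 + 1)) (N : 'M[R[i]]_(1 + 1, k + k))
  (Q1 Q2 : 'M[R]_k) :
  definite_bse H ->
  bse_krylov_III H X M E N ->
  orthogonalmx Q1 -> orthogonalmx Q2 ->
  let G : 'M[R[i]]_(k + k) := block_mx (to_complex Q1) 0 0 (to_complex Q2) in
  bse_krylov_III H (X *m G) (invmx G *m M *m G) E (N *m G).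
Proof.
move=> _ [U [V [u [v [K [kap [f [[XE ME EE NE] [HX f_or_kap free]]]]]]]]].
move=> o1 o2 G.
have GE : G = to_complex (block_mx Q1 0 0 Q2) by rewrite to_complex_block_diag.
have oG := orthogonal_block_diag o1 o2.
have uG : G \in unitmx by rewrite GE to_complex_orthogonal_unit.
exists (U *m to_complex Q1), (V *m to_complex Q2), u, v.
exists (Q1^T *m K *m Q2), (Q2^T *m kap), (Q1^T *m f).
split; split.
- by rewrite XE bse_block_mul_real.
- rewrite GE invmx_to_complex_orthogonal // tr_block_mx !trmx0.
  rewrite !to_complex_block_diag ME !mulmx_block.
  rewrite !(mulmx0, mul0mx, addr0, add0r) !adjoint_to_complex.
  by rewrite -!to_complexM !trmx_mul trmxK !mulmxA.
- exact: EE.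
- rewrite NE mulmx_block !(mulmx0, mul0mx, addr0, add0r) !adjoint_to_complex.
  by rewrite -!to_complexM !trmx_mul !trmxK.
- by rewrite !mulmxA mulmxK // HX mulmxDl.
- by case: f_or_kap => ->; rewrite mulmx0; [left | right].
- rewrite !row_mx_mul_block_diag1 -bse_block_mul_real -to_complex_block_diag.
  apply: row_free_tr_mul_unit free; apply: to_complex_orthogonal_unit.
  by do 2?apply: orthogonal_block_diag => //; rewrite /orthogonalmx trmx1 mulmx1.
Qed.
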